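(* For all integers $t,k\ge 0$, $$w(t,k+1)=w(t-1,k+1)+w(t+1,k),$$ where $w(-1,\cdot)=0$.
   Context: A Temperley-Lieb diagram $t\to n$ is a planar non-crossing perfect matching (up to isotopy) of $t$ points on a bottom line and $n$ points on a top line, drawn in the strip between the lines. It is monic if every bottom point is joined to a top point. The cell module $W_t(n)$ of the Temperley-Lieb algebra $TL_n(q)$ is the $\mathbb{C}$-vector space with basis the monic diagrams $t\to n$ (it is zero unless $0\le t\le n$, $t\equiv n\bmod 2$). For $t,k\ge0$, $w(t,k):=\dim W_t(t+2k)$, i.e. the number of monic diagrams $t\to t+2k$. *)

(* Defs.v *)
From HB Require Import structures.
From mathcomp Require Import all_boot all_order all_algebra.
From mathcomp Require Import complex.
From mathcomp Require Import Rstruct.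

Set Implicit Arguments.
Unset Strict Implicit.
Unset Printing Implicit Defensive.

Import GRing.Theory.

Definition C : fieldType := Rdefinitions.R[i].

Section Diagrams.
Variables t n : nat.

(* [inl i] is the i-th bottom point and [inr j] the j-th top point, both       *)
(* numbered from left to right.                                               *)
Definition tl_point : finType := ('I_t + 'I_n)%type.

(* Rank of a point when the boundary of the strip is traversed along the      *)
(* bottom line from left to right, then along the top line from right to left.*)
Definition boundary_rank (p : tl_point) : nat :=
  match p with
  | inl i => i
  | inr j => t + rev_ord j
  end.

Definition perfect_matching (D : {set {set tl_point}}) : bool :=
  partition D [set: tl_point] && [forall A in D, #|A| == 2].

(* Chords of a strip can be drawn disjointly iff no two of them have          *)
(* interleaved endpoints on the boundary.                                     *)
Definition noncrossing (D : {set {set tl_point}}) : bool :=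
  [forall a, forall b, forall c, forall d,
    [&& boundary_rank a < boundary_rank b,
        boundary_rank b < boundary_rank c &
        boundary_rank c < boundary_rank d]
    ==> ~~ (([set a; c] \in D) && ([set b; d] \in D))].

(* The isotopy class of a diagram is determined by its matching, so that      *)
(* diagrams up to isotopy are the noncrossing perfect matchings themselves.   *)
Record tl_diagram := TLDiagram {
  tl_pairs :> {set {set tl_point}};
  _ : perfect_matching tl_pairs && noncrossing tl_pairs }.

HB.instance Definition _ := [isSub for tl_pairs].
HB.instance Definition _ := [Finite of tl_diagram by <:].

Definition tl_monic (D : tl_diagram) : bool :=
  [forall i : 'I_t, exists j : 'I_n,
    [set (inl i : tl_point); inr j] \in tl_pairs D].

Definition monic_diagram : finType := {D : tl_diagram | tl_monic D}.

(* The free complex vector space on the monic diagrams, as functions from     *)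
(* this finite basis to the field of complex numbers. Its dimension does not  *)
(* involve the action of the Temperley-Lieb algebra, nor the parameter q.     *)
Definition cell_module : vectType C := {ffun monic_diagram -> C^o}.

End Diagrams.

(* [t] is an integer so that the convention w(-1, k) = 0 makes sense.         *)
Definition w (t : int) (k : nat) : nat :=
  match t with
  | Posz t' => \dim {: cell_module t' (t' + 2 * k)}
  | Negz _ => 0
  end.

(* Main.v *)
Require Import Defs.
From mathcomp Require Import all_boot all_order all_algebra.
From mathcomp Require Import zify.

(** Number the [t + n] boundary points of the strip along the bottom line from
    left to right and then along the top line from right to left. A diagram is
    a noncrossing matching of the numbers below [t + n], and it is monic iff no
    two numbers below [t] are joined; so, once [N = t + n] is fixed,
    the top and bottom lines matter only through the cut [t]. The numbers [w]
    therefore count the link patterns of size [N] with cut [t]: the noncrossing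
    fixed-point-free involutions [f] of the numbers below [N] with [t <= f x]
    for all [x < t] ([card_monic_link_patterns]).

    Fix [N] and look at the partner of the point [t], which is the rightmost
    top point.

    - If [t < f t], then [f] is a link pattern with cut [t.+1], and conversely:
      bending the rightmost top point down to the bottom line changes nothing
      in the boundary order ([card_link_patterns_split]).
    - If [f t < t], then [f t = t.-1]: otherwise [t.-1] would sit between the
      ends of the chord joining [f t] to [t], while its own partner, being at
      least [t], would lie outside. Deleting the adjacent points [t.-1] and [t]
      leaves a link pattern of size [N - 2] with cut [t.-1], and the inverse
      operation inserts a chord joining two new adjacent points
      ([card_link_patterns_cup]). This case cannot occur when [t = 0].

    The two cases have [w (t + 1) k] and [w (t - 1) k.+1] elements. *)

Set Implicit Arguments.
Unset Strict Implicit.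
Unset Printing Implicit Defensive.

(** * Matchings as fixed-point-free involutions *)

Definition pairs_of (T : finType) (f : T -> T) : {set {set T}} :=
  [set [set x; f x] | x : T].

Lemma mem_pairs_of (T : finType) (f : T -> T) (a b : T) :
  involutive f -> (forall x, f x != x) ->
  ([set a; b] \in pairs_of f) = (b == f a).
Proof.
move=> fK fN; apply/imsetP/eqP => [[x _ E]|->]; last by exists a.
have: a \in [set x; f x] by rewrite -E set21.
rewrite !inE => /orP[] /eqP ax.
- have: f x \in [set a; b] by rewrite E set22.
  by rewrite !inE ax (negbTE (fN x)) => /eqP.
- have: x \in [set a; b] by rewrite E set21.
  by rewrite !inE ax fK [x == _]eq_sym (negbTE (fN x)) => /eqP.
Qed.

Lemma pairs_of_partition (T : finType) (f : T -> T) :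
  involutive f -> (forall x, f x != x) ->
  partition (pairs_of f) [set: T] && [forall A in pairs_of f, #|A| == 2].
Proof.
move=> fK fN.
have blockE x z : z \in [set x; f x] -> [set x; f x] = [set z; f z].
  by rewrite !inE => /orP[] /eqP-> //; rewrite fK setUC.
apply/andP; split; last first.
  apply/forall_inP => _ /imsetP[x _ ->]; rewrite cards2 [x == _]eq_sym.
  by rewrite fN.
apply/and3P; split.
- rewrite eqEsubset subsetT; apply/subsetP => x _.
  by apply/bigcupP; exists [set x; f x]; [apply/imsetP; exists x | apply: set21].
- apply/trivIsetP => _ _ /imsetP[x _ ->] /imsetP[y _ ->].
  apply: contraR => /pred0Pn[z /= /andP[zx zy]].
  by rewrite (blockE _ _ zx) (blockE _ _ zy).
- apply/imsetP => -[x _ E].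
  by have := set21 x (f x); rewrite -E inE.
Qed.

(** The partner of [x] is the other element of the block of [x]; it is
    well defined because the blocks are disjoint, and this uniqueness also makes
    the partner map involutive. *)
Lemma partition_pairs_of (T : finType) (D : {set {set T}}) :
  partition D [set: T] -> [forall A in D, #|A| == 2] ->
  exists f : T -> T, [/\ involutive f, forall x, f x != x & D = pairs_of f].
Proof.
move=> /and3P[/eqP covD trivD _] /forall_inP D2.
have partner x : exists2 y, y != x & [set x; y] \in D.
  have xD : x \in cover D by rewrite covD inE.
  have BD := pblock_mem xD.
  have /cards2P[y [z [yz E]]] := D2 _ BD.
  have: x \in pblock D x by rewrite mem_pblock.
  rewrite E !inE => /orP[] /eqP xE.
  - by exists z; rewrite xE 1?eq_sym // -E.
  - by exists y; rewrite xE // setUC -E.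
have partner_uniq x y z : y != x -> [set x; y] \in D -> [set x; z] \in D -> y = z.
  move=> yx Dy Dz; have E : [set x; y] = [set x; z].
    by rewrite -(def_pblock trivD Dy (set21 x y)) (def_pblock trivD Dz (set21 x z)).
  have: y \in [set x; z] by rewrite -E set22.
  by rewrite !inE (negbTE yx) => /eqP.
have [f fN fD] := fin_all_exists2 partner.
exists f; split => //.
- by move=> x; apply: (partner_uniq (f x)); rewrite // setUC.
- apply/setP => A; apply/idP/imsetP => [AD | [x _ ->] //].
  have /cards2P[x [y [xy E]]] := D2 _ AD.
  exists x; rewrite // E; congr [set x; _].
  by apply: (partner_uniq x); rewrite 1?eq_sym // -E.
Qed.

(** * Link patterns *)

Section Patterns.
Variables t N : nat.

(** Two crossing chords satisfy [x < y < f x < f y] once [x] is the least of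
    the four ends and [y] the lower end of the other chord; so the second
    condition is that no two chords cross. *)
Definition link_pattern (f : {ffun 'I_N -> 'I_N}) : bool :=
  [&& [forall x, (f (f x) == x) && (f x != x)],
      [forall x : 'I_N, forall y : 'I_N, ~~ [&& x < y, y < f x & f x < f y]] &
      [forall x : 'I_N, (x < t) ==> (t <= f x)]].

Lemma link_patternP (f : {ffun 'I_N -> 'I_N}) :
  reflect [/\ involutive f, forall x, f x != x,
              forall x y : 'I_N, x < y -> y < f x -> f x < f y -> False &
              forall x : 'I_N, x < t -> t <= f x]
          (link_pattern f).
Proof.
apply: (iffP and3P) => [[/forallP H /forallP P /forallP M]|[fK fN P M]]; split.
- by move=> x; have /andP[/eqP] := H x.
- by move=> x; have /andP[] := H x.
- by move=> x y xy yx fxy; move: (forallP (P x) y); rewrite xy yx fxy.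
- by move=> x xt; move: (M x); rewrite xt.
- by apply/forallP => x; rewrite fK eqxx fN.
- apply/forallP => x; apply/forallP => y; apply/negP => /and3P[].
  exact: P.
- by apply/forallP => x; apply/implyP/M.
Qed.

End Patterns.

(** * Inserting a chord between two adjacent points *)

Section Insertion.
Variables (N t : nat).
Hypothesis tN : t <= N.

(* The new points are [p = t] and [q = t.+1], and [e] renumbers the old ones, *)
(* preserving their order. The point [t] of ['I_N.+1] is lifted over [p].     *)
Let p : 'I_N.+2 := inord t.
Let q : 'I_N.+2 := lift p (inord t : 'I_N.+1).
Let e (x : 'I_N) : 'I_N.+2 := lift p (lift (inord t : 'I_N.+1) x).

Let pE : p = t :> nat. Proof. by rewrite inordK //; lia. Qed.
Let qE : q = t.+1 :> nat. Proof. by rewrite /= /bump pE inordK //; lia. Qed.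
Let eE x : e x = (if x < t then x : nat else x.+2) :> nat.
Proof. by rewrite /= /bump pE inordK; [case: ifP; lia | lia]. Qed.

Let e_inj : injective e.
Proof. by move=> x y /lift_inj/lift_inj. Qed.

Let pos_cases x : [\/ x = p, x = q | exists z, x = e z].
Proof.
case: (unliftP p x) => [y -> | ->]; last by constructor 1.
case: (unliftP (inord t) y) => [z -> | ->]; last by constructor 2.
by constructor 3; exists z.
Qed.

Definition insert_cup (g : {ffun 'I_N -> 'I_N}) : {ffun 'I_N.+2 -> 'I_N.+2} :=
  [ffun x => if unlift p x is Some y then
               if unlift (inord t) y is Some z then e (g z) else p
             else q].

Let insert_p g : insert_cup g p = q.
Proof. by rewrite ffunE unlift_none. Qed.
Let insert_q g : insert_cup g q = p.
Proof. by rewrite ffunE liftK unlift_none. Qed.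
Let insert_e g z : insert_cup g (e z) = e (g z).
Proof. by rewrite ffunE !liftK. Qed.

Lemma insert_cup_inj : injective insert_cup.
Proof.
move=> g h E; apply/ffunP => z.
by apply: e_inj; rewrite -!insert_e E.
Qed.

(** The renumbering of the old points is increasing, so it keeps their chords
    noncrossing, and a chord between adjacent points crosses nothing. The cut
    moves up by one because exactly one of the two new points falls below it. *)
Lemma link_pattern_insert_cup (g : {ffun 'I_N -> 'I_N}) :
  link_pattern t.+1 (insert_cup g) = link_pattern t g.
Proof.
apply/link_patternP/link_patternP => -[fK fN P M]; split.
- by move=> z; apply: e_inj; rewrite -!insert_e fK.
- by move=> z; have := fN (e z); rewrite insert_e (inj_eq e_inj).
- move=> x y; have := P (e x) (e y); rewrite !insert_e !eE.
  by do ?[case: ifP]; lia.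
- by move=> x; have := M (e x); rewrite insert_e !eE; do ?[case: ifP]; lia.
- by move=> x; case: (pos_cases x) => [->|->|[z ->]];
    rewrite ?(insert_p, insert_q, insert_e) // fK.
- move=> x; case: (pos_cases x) => [->|->|[z ->]];
    rewrite ?(insert_p, insert_q, insert_e).
  + by apply/eqP => /(congr1 (@nat_of_ord _)); rewrite pE qE; lia.
  + by apply/eqP => /(congr1 (@nat_of_ord _)); rewrite pE qE; lia.
  + by rewrite (inj_eq e_inj) fN.
- move=> x y; case: (pos_cases x) => [->|->|[x' ->]];
  case: (pos_cases y) => [->|->|[y' ->]];
    rewrite ?(insert_p, insert_q, insert_e) ?pE ?qE ?eE; try (do ?[case: ifP]; lia).
  by have := P x' y'; do ?[case: ifP]; lia.
- move=> x; case: (pos_cases x) => [->|->|[z ->]];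
    rewrite ?(insert_p, insert_q, insert_e) ?pE ?qE ?eE; try lia.
  by have := M z; do ?[case: ifP]; lia.
Qed.

(** A link pattern whose chord at [t.+1] goes down must join [t.+1] to [t],
    since a chord ending lower would be crossed by the chord at [t]. The other
    points are then stable under [f]. *)
Lemma insert_cup_surj (f : {ffun 'I_N.+2 -> 'I_N.+2}) :
  link_pattern t.+1 f -> f (inord t.+1) < t.+1 -> exists g, f = insert_cup g.
Proof.
have <- : q = inord t.+1 by apply: ord_inj; rewrite qE inordK //; lia.
move=> /link_patternP[fK fN P M] fq.
have fqp : f q = p.
  apply: ord_inj; apply/eqP; apply: contraT => ne; exfalso.
  (* Otherwise [f q < p < q < f p], a crossing. *)
  apply: (P (f q) p); rewrite ?fK; first by lia.
  - lia.
  - have := M p; rewrite pE qE => /(_ (ltnSn t)).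
    rewrite leq_eqVlt => /orP[/eqP E | //].
    have qf : f p = q by apply: ord_inj; rewrite qE.
    by rewrite -qf fK eqxx in ne.
have fe z : exists y, f (e z) = e y.
  case: (pos_cases (f (e z))) => // E; exfalso.
  - have /(congr1 (@nat_of_ord _)) : e z = q by rewrite -[e z]fK E -fqp fK.
    by rewrite eE qE; case: ifP; lia.
  - have /(congr1 (@nat_of_ord _)) : e z = p by rewrite -[e z]fK E fqp.
    by rewrite eE pE; case: ifP; lia.
have [g gE] := fin_all_exists fe.
exists (finfun g); apply/ffunP => x.
case: (pos_cases x) => [->|->|[z ->]].
- by rewrite insert_p -fqp fK.
- by rewrite insert_q.
- by rewrite insert_e ffunE.
Qed.

Lemma insert_cup_lt (g : {ffun 'I_N -> 'I_N}) :
  insert_cup g (inord t.+1) < t.+1.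
Proof.
have <- : q = inord t.+1 by apply: ord_inj; rewrite qE inordK //; lia.
by rewrite insert_q pE.
Qed.

End Insertion.

(** * Counting link patterns *)

Definition link_patterns t N : {set {ffun 'I_N -> 'I_N}} :=
  [set f | link_pattern t f].

Lemma card_link_patterns_cup N t : t <= N ->
  #|[set f in link_patterns t.+1 N.+2 | f (inord t.+1) < t.+1]| = #|link_patterns t N|.
Proof.
move=> tN; rewrite -(card_imset _ (@insert_cup_inj N t)).
apply: eq_card => f; rewrite !inE; apply/andP/imsetP => [[fP ft]|[g]].
  have [g fE] := insert_cup_surj tN fP ft; exists g => //.
  by rewrite inE -link_pattern_insert_cup // -fE.
by rewrite inE => gP ->; rewrite link_pattern_insert_cup // insert_cup_lt.
Qed.

(** When the point [t] is not joined to a lower point, it may be counted among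
    the points below the cut: no lower point is joined to it, so the condition
    on those points is the same for both cuts. *)
Lemma card_link_patterns_split N t : t <= N ->
  #|link_patterns t N.+1| =
  #|[set f in link_patterns t N.+1 | f (inord t) < t]| + #|link_patterns t.+1 N.+1|.
Proof.
move=> tN; pose x0 : 'I_N.+1 := inord t.
have x0E : x0 = t :> nat by rewrite inordK.
rewrite -(cardsID [set f : {ffun 'I_N.+1 -> 'I_N.+1} | f x0 < t]).
congr (_ + _); first by apply: eq_card => f; rewrite !inE.
apply: eq_card => f; rewrite !inE -leqNgt.
apply/andP/idP => [[tf /link_patternP[fK fN P M]]|/link_patternP[fK fN P M]].
- apply/link_patternP; split=> // x; rewrite ltnS leq_eqVlt.
  have neq_t (y : 'I_N.+1) : y != x0 -> (y : nat) <> t.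
    by move=> /eqP ne yt; apply: ne; apply: ord_inj; rewrite x0E.
  case/orP => [/eqP xt | xt].
    have -> : x = x0 by apply: ord_inj; rewrite x0E.
    by have := neq_t _ (fN x0); lia.
  have fx0 : f x != x0.
    by apply: contraTneq xt => fx; rewrite -[x]fK fx -leqNgt.
  by rewrite ltn_neqAle M // andbT eq_sym; apply/eqP; apply: neq_t.
- split; first by have := M x0; rewrite x0E => /(_ (ltnSn t))/ltnW.
  by apply/link_patternP; split=> // x xt; apply/ltnW/M/ltnW.
Qed.

Lemma card_link_patterns_rec N t : t <= N ->
  #|link_patterns t.+1 N.+2| = #|link_patterns t N| + #|link_patterns t.+2 N.+2|.
Proof.
by move=> tN; rewrite card_link_patterns_split // card_link_patterns_cup.
Qed.

Lemma card_link_patterns0 N :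
  #|link_patterns 0 N.+1| = #|link_patterns 1 N.+1|.
Proof.
rewrite card_link_patterns_split // (_ : [set _ in _ | _] = set0) ?cards0 //.
by apply/setP => f; rewrite !inE andbF.
Qed.

(** * From diagrams to link patterns *)

Section Boundary.
Variables t n : nat.
Notation T := (tl_point t n).

Definition point_rank (p : T) : 'I_(t + n) :=
  match p with
  | inl i => lshift n i
  | inr j => rshift t (rev_ord j)
  end.

Definition rank_point (x : 'I_(t + n)) : T :=
  match split x with
  | inl i => inl i
  | inr j => inr (rev_ord j)
  end.

Lemma val_point_rank p : point_rank p = boundary_rank p :> nat.
Proof. by case: p. Qed.

Lemma point_rankK : cancel point_rank rank_point.
Proof.
case=> [i|j]; rewrite /rank_point /point_rank.
- by rewrite (unsplitK (inl i)).
- by rewrite (unsplitK (inr (rev_ord j))) rev_ordK.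
Qed.

Lemma rank_pointK : cancel rank_point point_rank.
Proof.
move=> x; rewrite /rank_point -{2}[x]splitK.
by case: (split x) => [i|j] //=; rewrite rev_ordK.
Qed.

Definition diagram_pairs (f : {ffun 'I_(t + n) -> 'I_(t + n)}) : {set {set T}} :=
  pairs_of (fun p => rank_point (f (point_rank p))).

Lemma transport_involution (f : {ffun 'I_(t + n) -> 'I_(t + n)}) :
  involutive f -> (forall x, f x != x) ->
  involutive (fun p => rank_point (f (point_rank p))) /\
  (forall p, rank_point (f (point_rank p)) != p).
Proof.
move=> fK fN; split=> p; first by rewrite rank_pointK fK point_rankK.
by rewrite -(inj_eq (can_inj point_rankK)) rank_pointK fN.
Qed.

Lemma mem_diagram_pairs (f : {ffun 'I_(t + n) -> 'I_(t + n)}) a b :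
  involutive f -> (forall x, f x != x) ->
  ([set a; b] \in diagram_pairs f) = (point_rank b == f (point_rank a)).
Proof.
move=> fK fN; have [gK gN] := transport_involution fK fN.
by rewrite mem_pairs_of // -(inj_eq (can_inj point_rankK)) rank_pointK.
Qed.

Definition monic_pairs (D : {set {set T}}) : bool :=
  [&& perfect_matching D, noncrossing D &
      [forall i : 'I_t, exists j : 'I_n, [set (inl i : T); inr j] \in D]].

Lemma card_monic_diagram : #|monic_diagram t n| = #|[set D | monic_pairs D]|.
Proof.
rewrite card_sig -(card_imset _ (@val_inj _ _ (tl_diagram t n))).
apply: eq_card => D; rewrite inE; apply/imsetP/and3P => [[[D' DP] /= DM ->]|[M NC mon]].
  by move: (DP) => /andP[]; split.
have DP : perfect_matching D && noncrossing D by rewrite M.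
by exists (TLDiagram DP).
Qed.

(** Noncrossing is a condition on ranks only, and a bottom point is joined to a
    top point iff the rank of its partner is at least [t]. *)
Lemma diagram_pairs_link (f : {ffun 'I_(t + n) -> 'I_(t + n)}) :
  involutive f -> (forall x, f x != x) ->
  monic_pairs (diagram_pairs f) = link_pattern t f.
Proof.
move=> fK fN; have [gK gN] := transport_involution fK fN.
have mem a b : ([set a; b] \in diagram_pairs f) = (point_rank b == f (point_rank a)).
  exact: mem_diagram_pairs.
rewrite /monic_pairs /perfect_matching pairs_of_partition //=.
apply/andP/link_patternP => [[NC mon]|[_ _ P M]]; split=> //.
- move=> x y xy yx fxy.
  move: NC => /forallP/(_ (rank_point x))/forallP/(_ (rank_point y)).
  move=> /forallP/(_ (rank_point (f x)))/forallP/(_ (rank_point (f y))).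
  by rewrite -!val_point_rank !mem !rank_pointK xy yx fxy !eqxx.
- move=> x xt; have /forallP/(_ (Ordinal xt))/existsP[j] := mon.
  have -> : [set (inl (Ordinal xt) : T); inr j] = [set rank_point x; inr j].
    by rewrite -[inl _]point_rankK; congr [set rank_point _; _]; apply: ord_inj.
  by rewrite mem rank_pointK => /eqP <-; rewrite leq_addr.
- apply/forallP => a; apply/forallP => b; apply/forallP => c; apply/forallP => d.
  rewrite -!val_point_rank !mem; apply/implyP => /and3P[ab bc cd].
  apply/negP => /andP[/eqP cE /eqP dE].
  by apply: (P (point_rank a) (point_rank b)); rewrite -?cE -?dE.
- apply/forallP => i; apply/existsP.
  have := M (point_rank (inl i)) (ltn_ord i).
  rewrite -[f _]rank_pointK; case E: (rank_point _) => [k|j].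
    by rewrite /= leqNgt ltn_ord.
  by exists j; rewrite mem -E rank_pointK.
Qed.

Lemma diagram_pairs_inj :
  {in link_patterns t (t + n) &, injective diagram_pairs}.
Proof.
move=> f g; rewrite !inE => /link_patternP[fK fN _ _] /link_patternP[gK gN _ _] E.
apply/ffunP => x; apply/eqP.
have := mem_diagram_pairs (rank_point x) (rank_point (f x)) gK gN.
by rewrite -E mem_diagram_pairs // !rank_pointK eqxx.
Qed.

Lemma diagram_pairs_surj (D : {set {set T}}) :
  perfect_matching D ->
  exists f : {ffun 'I_(t + n) -> 'I_(t + n)},
    [/\ involutive f, forall x, f x != x & D = diagram_pairs f].
Proof.
case/andP => partD /(partition_pairs_of partD)[g [gK gN ->]].
exists [ffun x => point_rank (g (rank_point x))]; split.
- by move=> x; rewrite !ffunE point_rankK gK rank_pointK.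
- by move=> x; rewrite ffunE -(inj_eq (can_inj rank_pointK)) point_rankK gN.
- by apply: eq_imset => p; rewrite ffunE !point_rankK.
Qed.

Lemma card_monic_link_patterns :
  #|monic_diagram t n| = #|link_patterns t (t + n)|.
Proof.
rewrite card_monic_diagram -(card_in_imset diagram_pairs_inj).
apply: eq_card => D; rewrite inE; apply/idP/imsetP => [mD | [f]].
  have /and3P[/diagram_pairs_surj[f [fK fN DE]] _ _] := mD.
  by exists f; rewrite // inE -diagram_pairs_link // -DE.
rewrite inE => fP ->; rewrite diagram_pairs_link //; by case/link_patternP: fP.
Qed.

End Boundary.

(** * The recurrence *)

Lemma dim_cell_module t n : \dim {: cell_module t n} = #|monic_diagram t n|.
Proof.
(* The dimension of a space of functions [I -> V] is by definition the       *)
(* product of the cardinal of [I] and the dimension of [V], which is 1 here. *)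
by rewrite dimvf [LHS]muln1.
Qed.

Theorem proposition4p2 (t k : nat) :
  w t%:Z k.+1 = w (t%:Z - 1)%R k.+1 + w (t%:Z + 1)%R k.
Proof.
case: t => [|t].
- have -> : (0%:Z - 1)%R = Negz 0 by [].
  have -> : (0%:Z + 1)%R = Posz 1 by [].
  rewrite /w !dim_cell_module !card_monic_link_patterns add0n mulnS.
  exact: card_link_patterns0.
- have -> : (t.+1%:Z - 1)%R = Posz t by lia.
  have -> : (t.+1%:Z + 1)%R = Posz t.+2 by lia.
  rewrite /w !dim_cell_module !card_monic_link_patterns.
  have -> : t.+1 + (t.+1 + 2 * k.+1) = (t + (t + 2 * k.+1)).+2 by lia.
  have -> : t.+2 + (t.+2 + 2 * k) = (t + (t + 2 * k.+1)).+2 by lia.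
  by apply: card_link_patterns_rec; apply: leq_addr.
Qed.
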